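(* Let $p$ be an odd prime and $n$ a positive integer. Let $\langle\langle*,*\rangle\rangle$ be the standard non-degenerate symplectic bilinear form on $\mathbb{F}_p^{2n}$, $\langle\langle v,w\rangle\rangle=\sum_{i=1}^n(v_iw_{n+i}-v_{n+i}w_i)$, with Gram matrix $\Delta=\begin{pmatrix}0&I_n\\-I_n&0\end{pmatrix}$. Let $e_i=e_i^{2n}$, $f_i=e_{n+i}^{2n}$ ($1\le i\le n$) be the standard basis vectors of $\mathbb{F}_p^{2n}$ and $V_1=\langle e_2,e_3,\ldots,e_n,f_1,f_2,\ldots,f_n\rangle$. Let $X=\{N\in M_{2n}(\mathbb{F}_p)\mid N^t\Delta N=0\}$ and $Y=\{N\in M_{2n}(\mathbb{F}_p)\mid N^t\Delta N=0,\ \mathrm{Im}(N)\subseteq V_1\}$. For $0\le k\le n$ let $\alpha_k(p,n)$ be the number of $k$-dimensional isotropic subspaces of $\mathbb{F}_p^{2n}$, let $\beta_k(p,n)$ be the number of $k$-dimensional isotropic subspaces of $\mathbb{F}_p^{2n}$ contained in $V_1$, and let $\gamma_k(p,n)$ be the number of surjective linear maps $\mathbb{F}_p^{2n}\to\mathbb{F}_p^k$. Then: (1) $|X|=\sum_{k=0}^n\alpha_k(p,n)\gamma_k(p,n)$. (2) $|Y|=\sum_{k=0}^n\beta_k(p,n)\gamma_k(p,n)$. (3) For each $0\le k\le n$, $\alpha_k(p,n)$ and $\beta_k(p,n)$ are polynomials in $p$ with non-negative integer coefficients, with (a) $\alpha_0(p,n)=1$ and, for $1\le k\le n$, $\alpha_k(p,n)=\binom{n}{k}_p\prod_{i=0}^{k-1}(p^{n-i}+1)$;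 (b) $\beta_0(p,n)=1$, $\beta_1(p,n)=\binom{2n-1}{1}_p$ and, for $2\le k\le n$, $\beta_k(p,n)=\Big(p^k(p^{n-k}+1)\binom{n-1}{k}_p+\binom{n-1}{k-1}_p\Big)\prod_{i=1}^{k-1}(p^{n-i}+1)$. (4) For each $0\le k\le n$, $\gamma_k(p,n)$ is a polynomial in $p$ with integer coefficients, with $\gamma_0(p,n)=1$ and, for $1\le k\le n$, $\gamma_k(p,n)=p^{2nk}-\sum_{i=0}^{k-1}\binom{k}{i}_p\gamma_i(p,n)$.
   Context: A subspace $W\subset\mathbb{F}_p^{2n}$ is isotropic if $\langle\langle v,w\rangle\rangle=0$ for all $v,w\in W$. $\binom{m}{k}_p$ denotes the $p$-binomial (Gaussian binomial) coefficient, i.e. the number of $k$-dimensional subspaces of $\mathbb{F}_p^m$ (zero when $k>m$). $^t$ denotes transpose. *)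

(* Defs.v *)
From HB Require Import structures.
From mathcomp Require Import all_boot all_order all_algebra.

Set Implicit Arguments.
Unset Strict Implicit.
Unset Printing Implicit Defensive.

Import Order.TTheory GRing.Theory Num.Theory.
Import VectorInternalTheory.
Local Open Scope ring_scope.

(* MathComp equips neither subspaces nor linear maps over a finite field with
   a finType structure; both are subtypes of a finite type of matrices. *)
HB.instance Definition _ (F : finFieldType) (vT : vectType F) :=
  [Countable of {vspace vT} by <:].
HB.instance Definition _ (F : finFieldType) (vT : vectType F) :=
  [Finite of {vspace vT} by <:].
HB.instance Definition _ (F : finFieldType) (aT rT : vectType F) :=
  [Countable of 'Hom(aT, rT) by <:].
HB.instance Definition _ (F : finFieldType) (aT rT : vectType F) :=
  [Finite of 'Hom(aT, rT) by <:].

Definition gbinom (p m k : nat) : nat :=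
  #|[set W : {vspace 'cV['F_p]_m} | \dim W == k]|.

(* Vectors of F_p^{2n} are columns of height n + n: coordinate i of the first
   half is lshift n i, coordinate n + i is rshift n i, and indices start at 0. *)
Definition symp (p n : nat) (v w : 'cV['F_p]_(n + n)) : 'F_p :=
  \sum_(i < n) (v (lshift n i) 0 * w (rshift n i) 0
                - v (rshift n i) 0 * w (lshift n i) 0).

Definition Delta (p n : nat) : 'M['F_p]_(n + n) :=
  block_mx 0 1%:M (- 1%:M) 0.

Lemma symp_Delta (p n : nat) (v w : 'cV['F_p]_(n + n)) :
  symp v w = (v^T *m Delta p n *m w) 0 0.
Proof.
rewrite -[v in RHS]vsubmxK -[w in RHS]vsubmxK /Delta tr_col_mx mul_row_block.
rewrite !mulmx0 add0r addr0 mulmxN !mulmx1 mul_row_col mulNmx addrC /symp sumrB.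
by rewrite !mxE; congr (_ - _); apply: eq_bigr => i _; rewrite !mxE.
Qed.

Definition isotropic (p n : nat) (W : {vspace 'cV['F_p]_(n + n)}) : bool :=
  [forall v, forall w, (v \in W) ==> (w \in W) ==> (symp v w == 0)].

Definition basis_e (p n : nat) (i : 'I_n) : 'cV['F_p]_(n + n) :=
  delta_mx (lshift n i) 0.
Definition basis_f (p n : nat) (i : 'I_n) : 'cV['F_p]_(n + n) :=
  delta_mx (rshift n i) 0.

(* The omitted vector e_1 is basis_e p i with val i = 0. *)
Definition V1 (p n : nat) : {vspace 'cV['F_p]_(n + n)} :=
  <<[seq basis_e p i | i <- enum 'I_n & val i != 0%N]
    ++ [seq basis_f p i | i <- enum 'I_n]>>%VS.

Definition Im (p m : nat) (N : 'M['F_p]_m) : {vspace 'cV['F_p]_m} :=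
  limg (linfun (mulmx N : 'cV['F_p]_m -> 'cV['F_p]_m)).

Definition X (p n : nat) : {set 'M['F_p]_(n + n)} :=
  [set N : 'M['F_p]_(n + n) | N^T *m Delta p n *m N == 0].

Definition Y (p n : nat) : {set 'M['F_p]_(n + n)} :=
  [set N : 'M['F_p]_(n + n) |
     (N^T *m Delta p n *m N == 0) && (Im N <= V1 p n)%VS].

Definition alpha (p n k : nat) : nat :=
  #|[set W : {vspace 'cV['F_p]_(n + n)} | (\dim W == k) && isotropic W]|.

Definition beta (p n k : nat) : nat :=
  #|[set W : {vspace 'cV['F_p]_(n + n)} |
      [&& \dim W == k, isotropic W & (W <= V1 p n)%VS]]|.

Definition gamma (p n k : nat) : nat :=
  #|[set f : 'Hom('cV['F_p]_(n + n), 'cV['F_p]_k) | limg f == fullv]|.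

(* Main.v *)
(* A frame of a subspace W over U is a k-tuple completing U to W.  Extending
   tuples one vector at a time counts the frames of all W at once, and every W
   has the same number of them; dividing gives all the subspace counts.  For an
   isotropic W the admissible next vectors form perp W minus W, where
   dim (perp W) = 2n - dim W.  As V_1 is the orthogonal of f_1, the isotropic W
   in V_1 split into those containing f_1 and those with f_1 not in W but
   W + <f_1> isotropic.  Matrices are counted by their image W, the maps with
   image W corresponding to the surjections onto F_p^(dim W). *)
From HB Require Import structures.
Require Import Defs.
From mathcomp Require Import all_boot all_order all_algebra zify.

Set Implicit Arguments.
Unset Strict Implicit.
Unset Printing Implicit Defensive.

Import Order.TTheory GRing.Theory Num.Theory.
Local Open Scope ring_scope.

(** * Counting subspaces by frames *)

Section CountSubspaces.
Variables (F : finFieldType) (m : nat).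
Local Notation V := 'cV[F]_m.
Implicit Types (U W : {vspace V}) (P : pred {vspace V}).

Lemma card_vspace_cV W : #|[set v | v \in W]| = (#|F| ^ \dim W)%N.
Proof.
pose h (c : 'rV[F]_(\dim W)) : V := \sum_i c 0 i *: (vbasis W)`_i.
have hW : basis_of W (vbasis W) := vbasisP W.
have -> : [set v | v \in W] = h @: setT.
  apply/setP=> v; rewrite inE; apply/idP/imsetP => [vW | [c _ ->]]; last first.
    by apply: memv_suml => i _; rewrite memvZ // vbasis_mem // mem_nth ?size_tuple.
  exists (\row_i coord (vbasis W) i v) => //.
  by rewrite {1}(coord_vbasis vW); apply: eq_bigr => i _; rewrite mxE.
rewrite card_imset ?cardsT ?card_mx ?mul1n // => c d eq_cd.
apply/rowP=> i; move/(congr1 (coord (vbasis W) i)): eq_cd.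
by rewrite !coord_sum_free ?(basis_free hW).
Qed.

Lemma card_vspaceD U W : (U <= W)%VS ->
  #|[set v | (v \notin U) && (v \in W)]| = (#|F| ^ \dim W - #|F| ^ \dim U)%N.
Proof.
move=> sUW; rewrite -!card_vspace_cV.
have -> : [set v | (v \notin U) && (v \in W)]
    = [set v | v \in W] :\: [set v | v \in U].
  by apply/setP=> v; rewrite !inE.
rewrite cardsD; congr (_ - #|pred_of_set _|)%N; apply/setP=> v; rewrite !inE.
by case vU: (v \in U); rewrite ?andbF // (subvP sUW).
Qed.

Definition frames P U k : {set k.-tuple V} :=
  [set t : k.-tuple V | P (U + <<t>>)%VS && (\dim (U + <<t>>) == \dim U + k)%N].

Lemma dimv_add_line W v : \dim (W + <[v]>) = (\dim W + (v \notin W))%N.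
Proof.
have [vW | vNW] := boolP (v \in W); first by rewrite (addv_idPl _) ?addn0 // -memvE.
rewrite dimv_disjoint_sum ?dim_vline; last first.
  apply/eqP; rewrite -subv0; apply/subvP=> w; rewrite memv_cap memv0.
  case/andP=> wW /vlineP[c def_w]; move: wW; rewrite {w}def_w.
  have [->|c_neq0 cvW] := eqVneq c 0; first by rewrite scale0r.
  by case/negP: vNW; rewrite -(scalerK c_neq0 v) memvZ.
by case: eqP vNW => // ->; rewrite mem0v.
Qed.

Lemma addv_span_cons U v (t : seq V) : (U + <<v :: t>> = U + <<t>> + <[v]>)%VS.
Proof. by rewrite span_cons (addvC <[v]>%VS) addvA. Qed.

(** Induction on [k], adding the new vector at the head of the tuple. As [P] passes to smaller
    subspaces above [U], the tail of a frame is again a frame, and the number of admissible heads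
    depends only on the dimension reached so far. *)
Lemma card_frames P U k (N : nat -> nat) :
    P U ->
    (forall W W', (U <= W)%VS -> (W <= W')%VS -> P W' -> P W) ->
    (forall i W, (i < k)%N -> (U <= W)%VS -> P W -> \dim W = (\dim U + i)%N ->
       #|[set v | (v \notin W) && P (W + <[v]>)%VS]| = N i) ->
  #|frames P U k| = (\prod_(0 <= i < k) N i)%N.
Proof.
move=> PU Pdown; elim: k => [|k IHk] ext.
  rewrite big_geq // (_ : frames P U 0 = setT) ?cardsT ?card_tuple //.
  by apply/setP=> t; rewrite !inE tuple0 span_nil addv0 PU addn0 eqxx.
rewrite big_nat_recr //= -IHk => [|i W lt_ik]; last exact/ext/ltnW.
have behead_frames t : t \in frames P U k.+1 -> behead_tuple t \in frames P U k.
  case/tupleP: t => v t; rewrite !inE /= addv_span_cons.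
  case/andP=> Pt /eqP dim_t; rewrite (Pdown _ _ (addvSl _ _) (addvSl _ _) Pt) /=.
  (* The tail contributes at most [k] dimensions and the head at most one, so a total of [k.+1]
     forces both bounds to be attained. *)
  have le_dim : (\dim (U + <<t>>) <= \dim U + k)%N.
    rewrite (leq_trans (dimv_add_leqif _ _)) // leq_add2l.
    by rewrite -[k in leqRHS](size_tuple t) dim_span.
  move: dim_t le_dim; rewrite dimv_add_line eqn_leq => + ->.
  by case: (v \notin _); lia.
rewrite -[LHS]sum1_card
  (partition_big (fun t : k.+1.-tuple V => behead_tuple t)
    (fun s => s \in frames P U k) behead_frames) /=.
(* The fibre over a tail [s] is in bijection with the vectors admissible for [U + <<s>>], a subspace
   of dimension [\dim U + k]. *)
rewrite -sum_nat_const; apply: eq_bigr => s s_frame.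
have:= s_frame; rewrite inE => /andP[Ps /eqP dim_s].
rewrite -(ext k (U + <<s>>)%VS) ?addvSl // sum1_card.
rewrite -(@card_imset _ _ (fun v => [tuple of v :: s])) => [|v w []//].
apply: eq_card => t; apply/andP/imsetP => [[]|[v]].
  case/tupleP: t => v t + /eqP def_s.
  have {def_s} -> : t = s by rewrite -def_s; apply/val_inj.
  rewrite inE /= addv_span_cons => /andP[Pv /eqP dim_v].
  exists v => //; rewrite inE Pv andbT.
  by move: dim_v; rewrite dimv_add_line dim_s; case: (v \notin _) => //= ?; lia.
rewrite inE => /andP[vNs Pv] ->; split; last by apply/eqP/val_inj.
by rewrite inE /= addv_span_cons Pv dimv_add_line dim_s vNs -addnA addn1 eqxx.
Qed.

(** Double counting of the frames: grouped by the subspace they generate with [U], they form fibres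
    of equal size. The identity is left as a product, so that no division of natural numbers occurs;
    later uses cancel the positive factor. *)
Lemma card_subspaces_frames P U k (N : nat -> nat) :
    P U ->
    (forall W W', (U <= W)%VS -> (W <= W')%VS -> P W' -> P W) ->
    (forall i W, (i < k)%N -> (U <= W)%VS -> P W -> \dim W = (\dim U + i)%N ->
       #|[set v | (v \notin W) && P (W + <[v]>)%VS]| = N i) ->
  (#|[set W | [&& (U <= W)%VS, P W & \dim W == \dim U + k]]|
     * \prod_(0 <= i < k) (#|F| ^ (\dim U + k) - #|F| ^ (\dim U + i))
   = \prod_(0 <= i < k) N i)%N.
Proof.
move=> PU Pdown ext; rewrite -(card_frames PU Pdown ext) -[RHS]sum1_card.
set S := [set W | _].
have spanS (t : k.-tuple V) : t \in frames P U k -> (U + <<t>>)%VS \in S.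
  by rewrite !inE addvSl.
rewrite (partition_big _ (mem S) spanS) /= -sum_nat_const.
apply: eq_bigr => W; rewrite inE => /and3P[sUW PW /eqP dimW].
(* The size of the fibre over [W] comes from [card_frames] again, now for the predicate of lying
   inside [W]: the next vector ranges over [W] minus the subspace already reached. For full-length
   tuples, lying inside [W] means generating [W], by equality of dimensions. *)
rewrite sum1_card -(@card_frames (fun W' => W' <= W)%VS U k) //; first last.
- move=> i W' _ _ sW'W dimW'; rewrite -dimW -dimW' -card_vspaceD //.
  by apply: eq_card => v; rewrite !inE subv_add sW'W memvE.
- by move=> W1 W2 _; apply: subv_trans.
apply: eq_card => t.
transitivity ((t \in frames P U k) && (U + <<t>> == W)%VS); last by [].
rewrite !inE; have [eqW | neqW] := eqVneq (U + <<t>>)%VS W.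
  by rewrite eqW PW subvv andbT.
rewrite andbF; apply/negP => /andP[sW /eqP dimt].
by case/eqP: neqW; apply/eqP; rewrite eqEdim sW dimW dimt /=.
Qed.

End CountSubspaces.

(** * Counting linear maps by their image *)

Definition linmx (F : finFieldType) (a b : nat) (N : 'M[F]_(b, a)) :
    'Hom('cV[F]_a, 'cV[F]_b) :=
  linfun (mulmx N : 'cV[F]_a -> 'cV[F]_b).

Section CountHom.
Variables (F : finFieldType) (a b : nat).
Implicit Types (W : {vspace 'cV[F]_b}) (P : pred {vspace 'cV[F]_b}).

Lemma linmx_bij : bijective (@linmx F a b).
Proof.
pose mx (f : 'Hom('cV[F]_a, 'cV[F]_b)) := \matrix_(i, j) f (delta_mx j 0) i 0.
exists mx => [N | f].
  by apply/matrixP=> i j; rewrite mxE lfunE /= -colE mxE.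
apply/lfunP=> v; rewrite lfunE /= [v in RHS]matrix_sum_delta linear_sum /=.
apply/colP=> i; rewrite mxE summxE; apply: eq_bigr => j _.
by rewrite big_ord1 linearZ !mxE /= mulrC.
Qed.

Lemma card_Hom : #|{: 'Hom('cV[F]_a, 'cV[F]_b)}| = (#|F| ^ (b * a))%N.
Proof. by rewrite -card_mx (bij_eq_card linmx_bij). Qed.

(** A basis of [W] gives an injective map [g] from the coordinate space onto [W]; composition with
    [g] turns the surjections onto the coordinate space into the maps with image [W]. *)
Lemma card_limg_eq W :
  #|[set f : 'Hom('cV[F]_a, 'cV[F]_b) | limg f == W]|
  = #|[set f : 'Hom('cV[F]_a, 'cV[F]_(\dim W)) | limg f == fullv]|.
Proof.
pose g := linmx (\matrix_(i < b, j < \dim W) (vbasis W)`_j i 0).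
have gE c : g c = \sum_i c i 0 *: (vbasis W)`_i.
  rewrite lfunE; apply/colP=> i; rewrite mxE summxE.
  by apply: eq_bigr => j _; rewrite !mxE mulrC.
have ker_g : lker g == 0%VS.
  apply/lker0P => c d; rewrite !gE => eq_cd; apply/colP=> i.
  move/(congr1 (coord (vbasis W) i)): eq_cd.
  by rewrite !coord_sum_free ?(basis_free (vbasisP W)).
have img_g : limg g = W.
  apply/eqP; rewrite eqEsubv; apply/andP; split; apply/subvP=> v.
    case/memv_imgP => c _ ->; rewrite gE.
    by apply: memv_suml => i _; rewrite memvZ // vbasis_mem // mem_nth ?size_tuple.
  move=> vW; have -> : v = g (\col_i coord (vbasis W) i v).
    by rewrite gE {1}(coord_vbasis vW); apply: eq_bigr => i _; rewrite mxE.
  by rewrite memv_img ?memvf.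
rewrite -(@card_imset _ _ (fun f => (g \o f)%VF)); last first.
  apply: can_inj (fun f => (g^-1 \o f)%VF) _ => f.
  by rewrite comp_lfunA lker0_compVf ?comp_lfun1l.
apply: eq_card => f; rewrite !inE; apply/eqP/imsetP => [img_f | [f']].
  exists (g^-1 \o f)%VF; rewrite ?inE.
    rewrite limg_comp img_f -[X in (_ @: X)%VS]img_g -limg_comp lker0_compVf //.
    apply/eqP/vspaceP=> v; rewrite memvf; apply/memv_imgP.
    by exists v; rewrite ?memvf ?id_lfunE.
  apply/lfunP=> v; rewrite !comp_lfunE limg_lfunVK //.
  by rewrite img_g -img_f memv_img ?memvf.
by rewrite inE => /eqP img_f' ->; rewrite limg_comp img_f' img_g.
Qed.

Lemma card_Hom_limg P :
  #|[set f : 'Hom('cV[F]_a, 'cV[F]_b) | P (limg f)]|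
  = (\sum_(0 <= k < b.+1) #|[set W | (\dim W == k) && P W]|
       * #|[set f : 'Hom('cV[F]_a, 'cV[F]_k) | limg f == fullv]|)%N.
Proof.
rewrite -sum1_card big_mkord.
have dim_lt W : (\dim W < b.+1)%N.
  by rewrite ltnS (leq_trans (dimvS (subvf W))) // dimvf /dim /= muln1.
rewrite (partition_big (fun f => limg f) P) /= => [|f]; last by rewrite inE.
rewrite (partition_big (fun W => Ordinal (dim_lt W)) predT) //=.
apply: eq_bigr => k _; rewrite -sum_nat_const; apply: eq_big => [W | W].
  by rewrite inE andbC.
case/andP=> PW /eqP/(congr1 val)/= <-; rewrite -card_limg_eq -sum1_card.
apply: eq_bigl => f; rewrite !inE; case: eqP => [->|]; rewrite ?PW ?andbF //.
Qed.

End CountHom.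

(** * The symplectic form, orthogonals and isotropic subspaces *)

Section Symplectic.
Variables (p n : nat).
Local Notation V := 'cV['F_p]_(n + n).
Implicit Types (U W : {vspace V}) (u v w : V).

Lemma sympC v w : symp w v = - symp v w.
Proof.
rewrite /symp -sumrN; apply: eq_bigr => i _.
by rewrite opprB [in LHS]mulrC [X in _ - X]mulrC.
Qed.

Lemma sympvv v : symp v v = 0.
Proof. by rewrite /symp big1 // => i _; rewrite mulrC subrr. Qed.

Lemma sympDr v w w' : symp v (w + w') = symp v w + symp v w'.
Proof.
rewrite /symp -big_split; apply: eq_bigr => i _ /=.
by rewrite !mxE !mulrDr opprD addrACA.
Qed.

Lemma sympZr x v w : symp v (x *: w) = x * symp v w.
Proof.
rewrite /symp mulr_sumr; apply: eq_bigr => i _ /=.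
by rewrite !mxE mulrBr !(mulrCA x).
Qed.

Lemma sympDl u v w : symp (u + v) w = symp u w + symp v w.
Proof. by rewrite sympC sympDr opprD -!sympC. Qed.

Lemma sympZl x v w : symp (x *: v) w = x * symp v w.
Proof. by rewrite sympC sympZr -mulrN -sympC. Qed.

Lemma symp0r v : symp v 0 = 0.
Proof. by rewrite -(scale0r 0) sympZr mul0r. Qed.

Lemma symp_sumr v (I : Type) (r : seq I) (f : I -> V) :
  symp v (\sum_(i <- r) f i) = \sum_(i <- r) symp v (f i).
Proof. exact: (big_morph (symp v) (sympDr v) (symp0r v)). Qed.

Lemma symp_basis_f v i : symp v (basis_f p i) = v (lshift n i) 0.
Proof.
rewrite /symp (bigD1 i) //= !mxE !eqxx eq_lrshift /= mulr1 mulr0 subr0.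
rewrite big1 ?addr0 // => j neq_ji.
by rewrite !mxE eq_lrshift (inj_eq (@rshift_inj _ _)) (negPf neq_ji) !mulr0 subr0.
Qed.

Lemma symp_basis_e v i : symp v (basis_e p i) = - v (rshift n i) 0.
Proof.
rewrite /symp (bigD1 i) //= !mxE !eqxx eq_rlshift /= mulr1 mulr0 sub0r.
rewrite big1 ?addr0 // => j neq_ji.
by rewrite !mxE eq_rlshift (inj_eq (@lshift_inj _ _)) (negPf neq_ji) !mulr0 subr0.
Qed.

(** Pairing with a basis of [W] presents the orthogonal of [W] as the kernel of a map into a space
    of dimension [\dim W], which opens the way to rank-nullity. *)
Definition pairing W : V -> 'cV['F_p]_(\dim W) :=
  fun v => \col_i symp v (vbasis W)`_i.

Lemma pairing_linear W : linear (pairing W).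
Proof.
move=> x u v; apply/colP=> i; rewrite !mxE.
by rewrite sympDl sympZl.
Qed.

HB.instance Definition _ W :=
  GRing.isLinear.Build _ _ _ _ (pairing W) (pairing_linear W).

Definition perp W : {vspace V} := lker (linfun (pairing W)).

Lemma perpP W v : reflect (forall w, w \in W -> symp v w = 0) (v \in perp W).
Proof.
rewrite memv_ker lfunE /=; apply: (iffP eqP) => [vW w wW | vW].
  rewrite (coord_vbasis wW) symp_sumr big1 // => i _.
  by move/colP/(_ i): vW; rewrite sympZr !mxE => ->; rewrite mulr0.
by apply/colP=> i; rewrite !mxE vW // vbasis_mem // mem_nth ?size_tuple.
Qed.

Lemma perp_full : perp fullv = 0%VS.
Proof.
apply/eqP; rewrite -subv0; apply/subvP=> v /perpP v_perp; rewrite memv0.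
apply/eqP/colP=> i; rewrite mxE; case: (split_ordP i) => j ->.
  by rewrite -symp_basis_f v_perp ?memvf.
by apply/eqP; rewrite -oppr_eq0 -symp_basis_e v_perp ?memvf.
Qed.

Lemma dim_cV (k : nat) : \dim {: 'cV['F_p]_k} = k.
Proof. by rewrite dimvf /dim /= muln1. Qed.

Lemma leq_dim_perp W : (n + n <= \dim (perp W) + \dim W)%N.
Proof.
rewrite -[leqLHS]dim_cV -(limg_ker_dim (linfun (pairing W)) fullv) capfv.
by rewrite leq_add2l -[leqRHS]dim_cV dimvS ?subvf.
Qed.

(** Rank-nullity bounds the dimensions of [perp W] and [perp W^C] from below, and these bounds add
    up to [n + n]. By non-degeneracy the two orthogonals meet only in 0, so their dimensions sum to
    at most [n + n], and both bounds are equalities. *)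
Lemma dim_perp W : (\dim (perp W) = n + n - \dim W)%N.
Proof.
have dimW : (\dim W <= n + n)%N by rewrite -[leqRHS]dim_cV dimvS ?subvf.
have dimC : (\dim W^C = n + n - \dim W)%N by rewrite dimv_compl dim_cV.
have := leq_dim_perp W; have := leq_dim_perp W^C.
have: (\dim (perp W + perp W^C) <= n + n)%N by rewrite -[leqRHS]dim_cV dimvS ?subvf.
rewrite dimv_disjoint_sum; first by rewrite dimC; lia.
apply/eqP; rewrite -subv0 -perp_full; apply/subvP=> v.
rewrite memv_cap => /andP[/perpP vW /perpP vC]; apply/perpP=> w _.
have: w \in (W + W^C)%VS by rewrite addv_complf memvf.
case/memv_addP => x xW [y yC ->].
by rewrite sympDr vW // vC // addr0.
Qed.

Lemma isotropicE W : isotropic W = (W <= perp W)%VS.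
Proof.
apply/forallP/subvP => [isoW v vW | isoW v].
  by apply/perpP=> w wW; move/forallP/(_ w): (isoW v); rewrite vW wW => /eqP.
by apply/forallP=> w; apply/implyP=> /isoW/perpP vW; apply/implyP=> /vW ->.
Qed.

Lemma isotropicP W :
  reflect (forall v w, v \in W -> w \in W -> symp v w = 0) (isotropic W).
Proof.
rewrite isotropicE.
apply: (iffP subvP) => [isoW v w /isoW/perpP | isoW v vW]; first exact.
by apply/perpP=> w; apply: isoW.
Qed.

Lemma isotropic_sub U W : (U <= W)%VS -> isotropic W -> isotropic U.
Proof.
move/subvP=> sUW /isotropicP isoW; apply/isotropicP=> v w /sUW vW /sUW.
exact: isoW.
Qed.

Lemma isotropic0 : isotropic (0%VS : {vspace V}).
Proof. by rewrite isotropicE sub0v. Qed.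

Lemma dim_isotropic W : isotropic W -> (\dim W <= n)%N.
Proof.
rewrite isotropicE => /dimvS; rewrite dim_perp.
have : (\dim W <= n + n)%N by rewrite -[leqRHS]dim_cV dimvS ?subvf.
lia.
Qed.

Lemma mem_perp_add_line W u v :
  (u \in perp (W + <[v]>)) = (u \in perp W) && (symp u v == 0).
Proof.
apply/perpP/andP => [uWv | [/perpP uW /eqP uv] x].
  by split; [apply/perpP=> w wW | apply/eqP]; apply: uWv;
    [apply: (subvP (addvSl _ _)) | apply: (subvP (addvSr _ _)); rewrite ?memv_line].
case/memv_addP=> w wW [_ /vlineP[c ->] ->].
by rewrite sympDr sympZr uW // uv mulr0 addr0.
Qed.

(** The form is alternating, so [v] pairs to 0 with itself and only its pairings with [W] impose a
    condition. *)
Lemma isotropic_add_line W v :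
  isotropic W -> isotropic (W + <[v]>) = (v \in perp W).
Proof.
rewrite !isotropicE subv_add => isoW.
rewrite -memvE mem_perp_add_line sympvv eqxx andbT.
case vW: (v \in _); rewrite ?andbF // andbT; apply/subvP=> w wW.
rewrite mem_perp_add_line (subvP isoW) // sympC oppr_eq0.
by have /perpP-> := vW.
Qed.

Lemma isotropic_line v : isotropic <[v]>.
Proof. 
rewrite -[<[v]>%VS]add0v isotropic_add_line ?isotropic0 //.
by apply/perpP=> w; rewrite memv0 => /eqP->; rewrite symp0r.
Qed.

End Symplectic.

(** * Gaussian binomials and the number of isotropic subspaces *)

Section QCount.
Variables (p : nat).
Hypothesis p_pr : prime p.
Local Open Scope nat_scope.

(** Raising all exponents by one costs a factor [p ^ k]; this compares counts made over a line with
    counts made over 0. *)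
Lemma prod_sub_expnS (a b : nat -> nat) k :
  p ^ k * \prod_(0 <= i < k) (p ^ a i - p ^ b i)
  = \prod_(0 <= i < k) (p ^ (a i).+1 - p ^ (b i).+1).
Proof.
under [RHS]eq_bigr do rewrite !expnS -mulnBr.
by rewrite big_split /= prod_nat_const_nat subn0.
Qed.

(** The number of linearly independent [k]-tuples in a space of dimension [m]. For [m < k] the
    factor at [i = m] makes it 0, as it should be. *)
Definition qfall m k := \prod_(0 <= i < k) (p ^ m - p ^ i).

Lemma qfall_gt0 k : 0 < qfall k k.
Proof.
rewrite /qfall big_mkord prodn_gt0 // => i.
by rewrite subn_gt0 ltn_exp2l ?prime_gt1.
Qed.

Lemma qfallSS m k : qfall m.+1 k.+1 = (p ^ m.+1 - 1) * p ^ k * qfall m k.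
Proof.
by rewrite /qfall big_nat_recl // -mulnA prod_sub_expnS.
Qed.

Lemma qfallS m k : qfall m k.+1 = qfall m k * (p ^ m - p ^ k).
Proof. by rewrite /qfall big_nat_recr. Qed.

Lemma qfall_eq0 m k : m < k -> qfall m k = 0.
Proof.
elim: k => // k IHk; rewrite ltnS leq_eqVlt qfallS => /orP[/eqP->|/IHk->//].
by rewrite subnn muln0.
Qed.

Lemma gbinom_qfall m k : gbinom p m k * qfall k k = qfall m k.
Proof.
rewrite /qfall.
rewrite -(@card_subspaces_frames 'F_p m predT 0%VS k (fun i => p ^ m - p ^ i)) //.
  rewrite dimv0 card_Fp //; congr (_ * _).
  by apply: eq_card => W; rewrite !inE sub0v.
move=> i W _ _ _; rewrite dimv0 => dimW.
have := card_vspaceD (subvf W); rewrite dimvf /dim /= muln1 dimW card_Fp // => <-.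
by apply: eq_card => v; rewrite !inE memvf.
Qed.

Lemma gbinom_m0 m : gbinom p m 0 = 1.
Proof. by have := gbinom_qfall m 0; rewrite /qfall !big_geq // muln1. Qed.

Lemma gbinom_0S k : gbinom p 0 k.+1 = 0.
Proof.
have := gbinom_qfall 0 k.+1; rewrite [RHS]qfall_eq0 // => /eqP.
by rewrite muln_eq0 (gtn_eqF (qfall_gt0 _)) orbF => /eqP.
Qed.

(** The Pascal rule for Gaussian binomials. After multiplication by [qfall k.+1 k.+1], every term is
    a multiple of [qfall m k]. For [m < k] that factor is 0; otherwise the cofactors satisfy
    (p^(k+1) - 1) p^k + p^(k+1) (p^m - p^k) = (p^(m+1) - 1) p^k. *)
Lemma gbinomSS m k :
  gbinom p m.+1 k.+1 = gbinom p m k + p ^ k.+1 * gbinom p m k.+1.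
Proof.
apply/eqP; rewrite -(eqn_pmul2r (qfall_gt0 k.+1)) gbinom_qfall mulnDl -mulnA.
rewrite gbinom_qfall [in X in _ == X + _]qfallSS mulnCA gbinom_qfall qfallSS qfallS.
have [lt_mk | le_km] := ltnP m k; first by rewrite !(qfall_eq0 lt_mk, muln0, mul0n).
rewrite [qfall m k * _]mulnC !mulnA -mulnDl; apply/eqP; congr (_ * _).
have: p ^ k <= p ^ m by rewrite leq_exp2l ?prime_gt1.
have: 0 < p ^ k by rewrite expn_gt0 prime_gt0.
(* Writing p^m as p^k + d removes one truncated subtraction and leaves a polynomial identity in [p],
   p^k and d. *)
rewrite !expnS => /[swap] /subnKC <-; rewrite addKn.
move: (p ^ k) (p ^ m - p ^ k) (prime_gt0 p_pr) => a d p_gt0 a_gt0.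
have pa_gt0 : 0 < p * a by rewrite muln_gt0 p_gt0.
nia.
Qed.

Lemma gbinom_mm m : gbinom p m m = 1.
Proof.
apply/eqP; rewrite -(eqn_pmul2r (qfall_gt0 m)) mul1n.
by rewrite gbinom_qfall.
Qed.

Lemma sub_expn_double m i :
  i <= m -> p ^ (m + m - i) - p ^ i = (p ^ m - p ^ i) * (p ^ (m - i) + 1).
Proof.
move=> le_im; rewrite mulnDr muln1 mulnBl -!expnD -addnBA // subnKC //.
have: p ^ i <= p ^ m by rewrite leq_exp2l ?prime_gt1.
have: p ^ m <= p ^ (m + (m - i)) by rewrite leq_exp2l ?prime_gt1 ?leq_addr.
lia.
Qed.

(** The left side counts the frames of isotropic [k]-spaces in dimension 2m. The bound reaches
    [m.+1] because the subspaces avoiding f_1 are counted with [m = n.-1] and [k] up to [n]; both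
    sides are then 0. *)
Lemma prod_sub_expn_double m k : k <= m.+1 ->
  \prod_(0 <= i < k) (p ^ (m + m - i) - p ^ i)
  = qfall m k * \prod_(0 <= i < k) (p ^ (m - i) + 1).
Proof.
move=> le_km; rewrite -big_split; apply: eq_big_nat => i /andP[_ lt_ik].
by rewrite sub_expn_double // -ltnS (leq_trans lt_ik).
Qed.

(** An isotropic [W] of dimension [i] is extended by the vectors of [perp W] outside [W], of which
    there are p^(2n-i) - p^i. *)
Lemma alphaE n k : k <= n ->
  alpha p n k = gbinom p n k * \prod_(0 <= i < k) (p ^ (n - i) + 1).
Proof.
move=> le_kn; apply/eqP; rewrite -(eqn_pmul2r (qfall_gt0 k)) mulnAC gbinom_qfall.
rewrite -prod_sub_expn_double ?leqW //.
rewrite -(@card_subspaces_frames _ _ (@isotropic p n) 0%VS k) ?isotropic0 //.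
- rewrite dimv0 card_Fp //; apply/eqP; congr (_ * _).
  by apply: eq_card => W; rewrite !inE sub0v andbC.
- by move=> W W' _; apply: isotropic_sub.
move=> i W _ _ isoW; rewrite dimv0 => dimW.
have := isoW; rewrite isotropicE => /card_vspaceD.
rewrite dim_perp dimW card_Fp // => <-.
by apply: eq_card => v; rewrite !inE isotropic_add_line.
Qed.

(** * Isotropic subspaces inside V_1, with [f0] standing for f_1 *)

Section Beta.
Variables (n : nat) (i0 : 'I_n).
Hypothesis i0_eq0 : val i0 = 0.
Local Notation f0 := (basis_f p i0).

(** Pairing with f_1 reads off the e_1-coordinate, the only one that vanishes on V_1. *)
Lemma V1_perp : V1 p n = perp <[f0]>%VS.
Proof.
have mem_perp v : (v \in perp <[f0]>%VS) = (v (lshift n i0) 0 == 0)%R.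
  rewrite -symp_basis_f -[<[_]>%VS]add0v mem_perp_add_line.
  case: perpP => // [[]] w; rewrite memv0 => /eqP->; exact: symp0r.
apply/eqP; rewrite eqEsubv; apply/andP; split.
  apply/span_subvP=> v; rewrite mem_cat mem_perp => /orP[] /mapP[i + ->].
    rewrite mem_filter => /andP[i_neq0 _]; rewrite mxE (inj_eq (@lshift_inj _ _)).
    case: (i0 =P i) => [eq_i|_]; last by rewrite eqxx.
    by rewrite -eq_i i0_eq0 in i_neq0.
  by rewrite mxE eq_lrshift.
apply/subvP=> v; rewrite mem_perp => /eqP v0.
rewrite [v]matrix_sum_delta; apply: memv_suml => i _; rewrite big_ord1.
case: (split_ordP i) => j ->; last first.
  rewrite memvZ // memv_span // mem_cat; apply/orP; right.
  by apply: (map_f (@basis_f p n)); rewrite mem_enum.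
have [-> | j_neq] := eqVneq j i0; first by rewrite v0 scale0r mem0v.
rewrite memvZ // memv_span // mem_cat; apply/orP; left.
apply: (map_f (@basis_e p n)); rewrite mem_filter mem_enum andbT.
by apply: contra j_neq => /eqP j0; apply/eqP/val_inj; rewrite j0 i0_eq0.
Qed.

Lemma dim_line_f0 : \dim <[f0]>%VS = 1.
Proof.
rewrite dim_vline; case: eqP => // /matrixP/(_ (rshift n i0) 0%R)/eqP.
by rewrite !mxE !eqxx oner_eq0.
Qed.

Lemma isotropic_sub_perp (W : {vspace 'cV['F_p]_(n + n)}) v :
  isotropic W -> isotropic (W + <[v]>)%VS = (W <= perp <[v]>)%VS.
Proof.
move=> isoW; rewrite isotropic_add_line //.
apply/perpP/subvP => [vW w wW | vW w /vW/perpP wv].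
  by apply/perpP=> _ /vlineP[x ->]; rewrite sympZr sympC vW // oppr0 mulr0.
by rewrite sympC wv ?memv_line ?oppr0.
Qed.

(** Frames over the line of f_1: at step [i] the subspace has dimension [i.+1]. Both products have
    their exponents shifted by one, so p^k cancels and the count for [n.-1] remains, as expected
    from the symplectic quotient of the orthogonal of f_1 by that line. *)
Lemma card_isotropic_mem k : k < n ->
  #|[set W : {vspace 'cV['F_p]_(n + n)} |
     [&& (<[f0]> <= W)%VS, isotropic W & \dim W == k.+1]]|
  = gbinom p n.-1 k * \prod_(0 <= i < k) (p ^ (n.-1 - i) + 1).
Proof.
move=> lt_kn; have n_gt0 : 0 < n by apply: leq_trans lt_kn.
have pk_gt0 : 0 < p ^ k by rewrite expn_gt0 prime_gt0.
apply/eqP; rewrite -(eqn_pmul2r (qfall_gt0 k)) mulnAC gbinom_qfall.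
rewrite -prod_sub_expn_double; last by rewrite prednK // ltnW.
rewrite -(eqn_pmul2l pk_gt0) mulnCA.
rewrite !prod_sub_expnS.
have iso_f0 := isotropic_line f0.
have := @card_subspaces_frames _ _ (@isotropic p n) <[f0]>%VS k
  (fun i => p ^ (n.-1 + n.-1 - i).+1 - p ^ i.+1) iso_f0.
rewrite dim_line_f0 card_Fp // => -> //.
- by move=> W W' _; apply: isotropic_sub.
move=> i W lt_ik _ isoW dimW.
have := isoW; rewrite isotropicE => /card_vspaceD.
rewrite dim_perp dimW card_Fp // add1n.
have -> : n + n - i.+1 = (n.-1 + n.-1 - i).+1 by lia.
by move=> <-; apply: eq_card => v; rewrite !inE isotropic_add_line.
Qed.

(** The numerator is the same as for the subspaces containing f_1, but frames now start from 0, so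
    the denominator is unshifted and p^k survives. Geometrically, a line in a space of dimension k +
    1 has p^k complements. *)
Lemma card_isotropic_notin k : k <= n ->
  #|[set W : {vspace 'cV['F_p]_(n + n)} |
     [&& isotropic (W + <[f0]>)%VS, f0 \notin W & \dim W == k]]|
  = p ^ k * gbinom p n.-1 k * \prod_(0 <= i < k) (p ^ (n.-1 - i) + 1).
Proof.
move=> le_kn; have n_gt0 : 0 < n by case: (i0) => /= j /(leq_trans _)->.
apply/eqP; rewrite -(eqn_pmul2r (qfall_gt0 k)) -!mulnA [X in _ == _ * (_ * X)]mulnC.
rewrite [X in _ == _ * X]mulnA gbinom_qfall -prod_sub_expn_double ?prednK //.
rewrite prod_sub_expnS.
pose P (W : {vspace 'cV['F_p]_(n + n)}) :=
  isotropic (W + <[f0]>)%VS && (f0 \notin W).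
rewrite -(@card_subspaces_frames _ _ P 0%VS k).
- rewrite dimv0 card_Fp //; apply/eqP; congr (_ * _).
  by apply: eq_card => W; rewrite !inE sub0v /P andbA.
- rewrite /P add0v isotropic_line memv0 -memv0.
  apply/negP; rewrite memv0 => /eqP f0_0.
  by have := dim_line_f0; rewrite f0_0 dim_vline eqxx.
- move=> W W' _ sWW' /andP[isoW' nW'].
  rewrite /P (isotropic_sub _ isoW') ?addvS //=.
  by apply: contra nW'; apply: (subvP sWW').
move=> i W lt_ik _ /andP[isoW nW]; rewrite dimv0 add0n => dimW.
have := isoW; rewrite isotropicE => /card_vspaceD.
rewrite dim_perp dimv_add_line nW dimW card_Fp // addn1.
have -> : n + n - i.+1 = (n.-1 + n.-1 - i).+1 by lia.
move=> <-; apply: eq_card => v; rewrite !inE /P.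
rewrite -addvA (addvC <[v]>%VS) addvA isotropic_add_line //.
rewrite [in RHS]andbC andbCA; congr (_ && _).
(* Computing the dimension of [W + <[v]> + <[f0]>] in both orders shows that [v] avoids [W + <[f0]>]
   exactly when [v] avoids [W] and [f0] avoids [W + <[v]>]. *)
have := dimv_add_line (W + <[f0]>)%VS v.
rewrite -addvA (addvC <[f0]>%VS) addvA !dimv_add_line nW.
have [vW _ | vW] := boolP (v \in W).
  by rewrite [v \in (_ + _)%VS](subvP (addvSl _ _)).
by case: (f0 \notin _); case: (v \notin _) => //=; lia.
Qed.

Lemma beta0 : beta p n 0 = 1.
Proof.
rewrite /beta (_ : [set W | _] = [set 0%VS]) ?cards1 //; apply/setP=> W.
rewrite !inE dimv_eq0; case: eqP => //= ->; by rewrite isotropic0 sub0v.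
Qed.

(** The first summand counts the subspaces avoiding f_1, the second those containing it. When
    [k.+1 = n] the first is 0, since an isotropic subspace of dimension n in V_1 must contain
    f_1. *)
Lemma betaS k : k < n ->
  beta p n k.+1 =
    p ^ k.+1 * gbinom p n.-1 k.+1 * \prod_(0 <= i < k.+1) (p ^ (n.-1 - i) + 1)
    + gbinom p n.-1 k * \prod_(0 <= i < k) (p ^ (n.-1 - i) + 1).
Proof.
move=> lt_kn; rewrite -card_isotropic_notin // -card_isotropic_mem //.
rewrite /beta -(cardsID [set W : {vspace 'cV['F_p]_(n + n)} | f0 \notin W]).
congr (_ + _); apply: eq_card => W; rewrite !inE V1_perp.
  case: (f0 \notin W); rewrite ?andbF // !andbT /= andbC; congr (_ && _).
  case isoW: (isotropic W); first by rewrite isotropic_sub_perp.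
  by apply/esym/negbTE; apply: contraFN isoW; apply/isotropic_sub/addvSl.
rewrite negbK -memvE; case f0W: (f0 \in W) => //=; rewrite andbC -andbA.
case isoW: (isotropic W) => //=; rewrite -isotropic_sub_perp // (addv_idPl _).
  by rewrite isoW.
by rewrite -memvE.
Qed.

(** Every line is isotropic, so this counts all lines of V_1, a space of dimension 2n - 1. *)
Lemma beta1 : beta p n 1 = gbinom p (2 * n - 1) 1.
Proof.
apply/eqP; rewrite -(eqn_pmul2r (qfall_gt0 1)) gbinom_qfall /qfall.
rewrite -(@card_subspaces_frames _ _ (fun W => W <= V1 p n)%VS 0%VS 1
  (fun i => p ^ (2 * n - 1) - p ^ i)) ?sub0v //.
- rewrite dimv0 card_Fp //; apply/eqP; congr (_ * _).
  apply: eq_card => W; rewrite !inE sub0v /= andbC -andbA.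
  case: eqP; rewrite ?andbF // andbT => dimW.
  rewrite andb_idl // => _; have W0 : W != 0%VS by rewrite -dimv_eq0 dimW.
  have -> : W = <[vpick W]>%VS.
    by apply/esym/eqP; rewrite eqEdim -memvE memv_pick dimW dim_vline vpick0 W0.
  exact: isotropic_line.
- by move=> W W' _; apply: subv_trans.
move=> i W _ _ sW; rewrite dimv0 => dimW; have := card_vspaceD sW.
rewrite dimW card_Fp // [in X in _ = X -> _]V1_perp dim_perp dim_line_f0.
rewrite mul2n -addnn => <-.
by apply: eq_card => v; rewrite !inE subv_add sW memvE.
Qed.

End Beta.
End QCount.

(** * Counting matrices by their image, and the recurrence for [gamma] *)

Section MatrixCount.
Variables (p n : nat).

(** The matrix on the left is the Gram matrix of the columns of [N], and these span the image. *)
Lemma isotropic_Im (N : 'M['F_p]_(n + n)) :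
  (N^T *m Delta p n *m N == 0) = isotropic (Defs.Im N).
Proof.
have sympN v w :
    symp (N *m v) (N *m w) = (v^T *m (N^T *m Delta p n *m N) *m w) 0 0.
  by rewrite symp_Delta trmx_mul !mulmxA.
apply/eqP/isotropicP => [N0 _ _ /memv_imgP[v _ ->] /memv_imgP[w _ ->] | isoN].
  by rewrite !lfunE /= sympN N0 mulmx0 mul0mx mxE.
have memN v : N *m v \in Defs.Im N.
  by apply/memv_imgP; exists v; rewrite ?memvf ?lfunE.
apply/matrixP=> i j; rewrite mxE.
have := isoN _ _ (memN (delta_mx i 0)) (memN (delta_mx j 0)).
by rewrite sympN trmx_delta -rowE -colE !mxE.
Qed.

Lemma card_isotropic_Im (P : pred {vspace 'cV['F_p]_(n + n)}) :
  #|[set N : 'M['F_p]_(n + n) | (N^T *m Delta p n *m N == 0) && P (Defs.Im N)]|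
  = (\sum_(0 <= k < n.+1) #|[set W : {vspace 'cV['F_p]_(n + n)} |
        [&& \dim W == k, isotropic W & P W]]| * gamma p n k)%N.
Proof.
have [linmxV linmxK linmxVK] := linmx_bij 'F_p (n + n) (n + n).
rewrite -(card_imset _ (can_inj linmxK)).
transitivity #|[set f : 'Hom('cV['F_p]_(n + n), 'cV['F_p]_(n + n)) |
                isotropic (limg f) && P (limg f)]|.
  apply: eq_card => f; rewrite -[f]linmxVK mem_imset; last exact: can_inj linmxK.
  by rewrite !inE isotropic_Im.
rewrite (@card_Hom_limg _ _ _ (fun W => isotropic W && P W)).
(* The image may have any dimension up to 2n, but the terms above n are 0 because isotropic
   subspaces have dimension at most n. *)
rewrite (@big_cat_nat _ _ _ n.+1) ?ltnS ?leq_addr //= [X in (_ + X)%N]big_nat_cond.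
rewrite [X in (_ + X)%N]big1 ?addn0 // => k /andP[/andP[lt_nk _] _].
rewrite (_ : [set W | _] = set0) ?cards0 //; apply/setP=> W; rewrite !inE.
apply/negP=> /and3P[/eqP dimW /dim_isotropic]; rewrite dimW.
by rewrite leqNgt lt_nk.
Qed.

Lemma card_X : #|X p n| = (\sum_(0 <= k < n.+1) alpha p n k * gamma p n k)%N.
Proof.
transitivity #|[set N : 'M['F_p]_(n + n) | (N^T *m Delta p n *m N == 0) && true]|.
  by apply: eq_card => N; rewrite !inE andbT.
rewrite (card_isotropic_Im predT); apply: eq_bigr => k _.
by congr (_ * _)%N; apply: eq_card => W; rewrite !inE andbT.
Qed.

Lemma card_Y : #|Y p n| = (\sum_(0 <= k < n.+1) beta p n k * gamma p n k)%N.
Proof. exact: (card_isotropic_Im (fun W => W <= V1 p n)%VS). Qed.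

Hypothesis p_pr : prime p.

(** All linear maps into the space of dimension [k] are counted according to the dimension of their
    image; the recurrence for [gamma] isolates the term [i = k]. *)
Lemma sum_gbinom_gamma k :
  (\sum_(0 <= i < k.+1) gbinom p k i * gamma p n i = p ^ (2 * n * k))%N.
Proof.
have := @card_Hom_limg 'F_p (n + n) k predT.
rewrite (_ : [set f | _] = setT) ?cardsT ?card_Hom ?card_Fp //.
rewrite mul2n -addnn mulnC => ->; apply: eq_bigr => i _.
by congr (_ * _)%N; apply: eq_card => W; rewrite !inE andbT.
Qed.

Lemma gammaE k :
  (gamma p n k)%:Z = (p ^ (2 * n * k))%N%:Z
     - \sum_(0 <= i < k) (gbinom p k i)%:Z * (gamma p n i)%:Z.
Proof.
rewrite -sum_gbinom_gamma big_nat_recr //= gbinom_mm // mul1n PoszD.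
under [X in _ - X]eq_bigr do rewrite -PoszM.
by rewrite -(big_morph _ PoszD (erefl _)) addrAC subrr add0r.
Qed.

End MatrixCount.

(** * Polynomials in p taking these counts as values *)

Fixpoint qbinpoly m k : {poly int} :=
  match m, k with
  | _, 0 => 1
  | 0, _.+1 => 0
  | m.+1, k.+1 => qbinpoly m k + 'X^(k.+1) * qbinpoly m k.+1
  end.

Lemma polyOver_nneg_coef (q : {poly int}) :
  q \is a polyOver (@Num.Def.nneg_num_pred int) ->
  forall i : nat, 0 <= q`_i.
Proof. by move/polyOverP. Qed.

(** The Pascal rule builds the polynomial from sums and products only, so no negative coefficient
    can arise. *)
Lemma qbinpoly_nneg m k :
  qbinpoly m k \is a polyOver (@Num.Def.nneg_num_pred int).
Proof.
elim: m k => [|m IHm] [|k] /=; rewrite ?rpred0 ?rpred1 //.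
by rewrite rpredD ?rpredM ?rpredX ?polyOverX.
Qed.

Lemma horner_qbinpoly p m k :
  prime p -> (gbinom p m k)%:Z = (qbinpoly m k).[p%:Z].
Proof.
move=> p_pr; elim: m k => [|m IHm] [|k] /=;
  rewrite ?gbinom_m0 ?gbinom_0S ?hornerE //.
by rewrite gbinomSS // PoszD PoszM !IHm -[(p ^ _)%N%:Z]natz natrX natz.
Qed.

Definition qplus_prod m k : {poly int} := \prod_(0 <= i < k) ('X^(m - i) + 1).

Lemma qplus_prod_nneg m k :
  qplus_prod m k \is a polyOver (@Num.Def.nneg_num_pred int).
Proof. by apply: rpred_prod => i _; rewrite rpredD ?rpredX ?polyOverX ?rpred1. Qed.

Lemma horner_qplus_prod p m k :
  (\prod_(0 <= i < k) (p ^ (m - i) + 1))%N%:Z = (qplus_prod m k).[p%:Z].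
Proof.
rewrite horner_prod (big_morph _ PoszM (erefl _)); apply: eq_bigr => i _.
by rewrite !hornerE PoszD -[(p ^ _)%N%:Z]natz natrX natz.
Qed.

Lemma gamma_poly n k : exists C : {poly int},
  forall p : nat, prime p -> (gamma p n k)%:Z = C.[p%:Z].
Proof.
(* The recurrence calls on all smaller indices, so the induction builds a whole family of
   polynomials, fixed before the prime is given. *)
suff [C CE] : exists C : nat -> {poly int}, forall i p : nat, (i < k.+1)%N ->
    prime p -> (gamma p n i)%:Z = (C i).[p%:Z].
  by exists (C k) => p; apply: CE.
elim: k.+1 => {k}[|k [C CE]]; first by exists (fun=> 0).
pose Ck := 'X^(2 * n * k) - \sum_(0 <= i < k) qbinpoly k i * C i.
exists (fun i => if (i < k)%N then C i else Ck) => i p; rewrite ltnS => le_ik p_pr.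
case: ltnP => [lt_ik | le_ki]; first exact: CE.
have -> : i = k by apply/eqP; rewrite eqn_leq le_ik.
rewrite gammaE // /Ck !hornerE -[(p ^ _)%N%:Z]natz natrX natz horner_sum.
congr (_ - _); apply: eq_big_nat => j /andP[_ lt_jk].
by rewrite hornerM -horner_qbinpoly // -CE.
Qed.

Theorem theorem5p2 (n : nat) (n_gt0 : (0 < n)%N) :
  (forall p : nat, prime p -> odd p ->
     #|X p n| = (\sum_(0 <= k < n.+1) alpha p n k * gamma p n k)%N) /\
  (forall p : nat, prime p -> odd p ->
     #|Y p n| = (\sum_(0 <= k < n.+1) beta p n k * gamma p n k)%N) /\
  ((forall k : nat, (k <= n)%N ->
      (exists A : {poly int}, (forall i : nat, 0 <= A`_i) /\
         forall p : nat, prime p -> odd p -> (alpha p n k)%:Z = A.[p%:Z]) /\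
      (exists B : {poly int}, (forall i : nat, 0 <= B`_i) /\
         forall p : nat, prime p -> odd p -> (beta p n k)%:Z = B.[p%:Z])) /\
   (forall p : nat, prime p -> odd p ->
      (alpha p n 0 = 1%N /\
       forall k : nat, (1 <= k <= n)%N ->
         alpha p n k
         = (gbinom p n k * \prod_(0 <= i < k) (p ^ (n - i) + 1))%N) /\
      (beta p n 0 = 1%N /\
       beta p n 1 = gbinom p (2 * n - 1) 1 /\
       forall k : nat, (2 <= k <= n)%N ->
         beta p n k
         = ((p ^ k * (p ^ (n - k) + 1) * gbinom p n.-1 k
             + gbinom p n.-1 k.-1)
            * \prod_(1 <= i < k) (p ^ (n - i) + 1))%N))) /\
  ((forall k : nat, (k <= n)%N ->
      exists C : {poly int},
        forall p : nat, prime p -> odd p -> (gamma p n k)%:Z = C.[p%:Z]) /\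
   (forall p : nat, prime p -> odd p ->
      gamma p n 0 = 1%N /\
      forall k : nat, (1 <= k <= n)%N ->
        (gamma p n k)%:Z
        = (p ^ (2 * n * k))%N%:Z
          - \sum_(0 <= i < k) (gbinom p k i)%:Z * (gamma p n i)%:Z)).
Proof.
pose i0 : 'I_n := Ordinal n_gt0; have i0E : val i0 = 0%N by [].
split; first by move=> p _ _; apply: card_X.
split; first by move=> p _ _; apply: card_Y.
split; [split | split].
- move=> k le_kn; split.
    (* A single polynomial must serve all primes, so each witness is read off a closed formula,
       using [n] and [k] only. *)
    exists (qbinpoly n k * qplus_prod n k); split.
      by apply: polyOver_nneg_coef; rewrite rpredM ?qbinpoly_nneg ?qplus_prod_nneg.
    move=> p p_pr _; rewrite alphaE // PoszM hornerM.
    by rewrite horner_qbinpoly // horner_qplus_prod.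
  case: k le_kn => [_ | k lt_kn].
    exists 1; split; first by apply: polyOver_nneg_coef; rewrite rpred1.
    by move=> p _ _; rewrite beta0 hornerC.
  exists ('X^(k.+1) * qbinpoly n.-1 k.+1 * qplus_prod n.-1 k.+1
          + qbinpoly n.-1 k * qplus_prod n.-1 k); split.
    apply: polyOver_nneg_coef; rewrite rpredD ?rpredM ?rpredX ?polyOverX //;
      by rewrite ?qbinpoly_nneg ?qplus_prod_nneg.
  move=> p p_pr _; rewrite (betaS p_pr i0E lt_kn) PoszD !PoszM !hornerE.
  rewrite !horner_qbinpoly // !horner_qplus_prod.
  by rewrite -[(p ^ _)%N%:Z]natz natrX natz.
- move=> p p_pr _; split; last split; first split.
  + by rewrite alphaE // gbinom_m0 // big_geq.
  + by move=> k /andP[_ le_kn]; apply: alphaE.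
  + exact: beta0.
  split; first exact: (beta1 p_pr i0E).
  case=> [|k] //= /andP[_ lt_kn]; rewrite (betaS p_pr i0E lt_kn) big_add1 /=.
  have sub_pred i : (n - i.+1 = n.-1 - i)%N by case: (n).
  under [in RHS]eq_bigr do rewrite sub_pred.
  (* The longer product of [betaS] has one extra last factor, at [i = k]; it is the factor p^(n-k)+1
     of the claim, whose [k] is [k.+1] here. *)
  by rewrite big_nat_recr //= sub_pred mulnDl; lia.
- move=> k _; have [C CE] := gamma_poly n k.
  by exists C => p p_pr _; apply: CE.
move=> p p_pr _; split; last by move=> k _; apply: gammaE.
(* The recurrence also holds at [k = 0], where the sum is empty and the power is p^0. *)
by apply/eqP; rewrite -eqz_nat gammaE // muln0 big_geq // subr0.
Qed.
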